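(* Let $G$ be a locally finite, infinite connected graph with subsets $S,T\subseteq V(G)$, and let $(G^{(n)})_{n\ge 1}$ be a sequence of finite induced subgraphs exhausting $G$ (with source set $S$ and target sets $T^{(n)}$). Define $a_{m,n}=\sum_{A\in\mathscr A_m(G^{(n)})}|\partial_S A|$ (the boundary being taken in $G^{(n)}$) and let $a_m:=\lim_{n\to\infty}a_{m,n}$. Assume that there are constants $b>0$ and $L\ge 0$ ($L$ an integer) such that (i) $|\partial_S A|\ge bm+1$ for all $A\in\mathscr A_m(G^{(n)})$, all $n\geq 1$ and all $m\ge L$, and (ii) the function $f(x)=\sum_{m=L}^\infty a_m x^m$ has radius of convergence at least $\frac{b^b}{(b+1)^{b+1}}$ and satisfies $$\int_0^1 f\big(x(1-x)^b\big)\,dx<\infty .$$ Then the sizes of the separation graphs, $\big|G^{(n)}_{\mathfrak S}\big|$, $n\ge 1$, form a tight family of random variables, i.e. for every $\varepsilon>0$ there is a constant $M$ such that $\mathbf P\big[|G^{(n)}_{\mathfrak S}|\ge M\big]<\varepsilon$ for all $n\geq 1$.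
   Context: Cutting procedure. Let $H$ be a finite simple connected graph with a nonempty set $S\subseteq V(H)$ of sources and a set $T_H\subseteq V(H)$ of targets. Put $H_0=H$. As long as $H_{i-1}$ is nonempty, choose $v_i\in V(H_{i-1})$ uniformly at random (independently of the past), delete $v_i$ and its incident edges, and discard all connected components that contain no source; the result is $H_i$. The process stops when the empty graph $\emptyset$ is reached. The separation number is $\mathfrak S(H)=\inf\{i\ge 0: V(H_i)\cap T_H=\emptyset\}$ and the separation graph is $H_{\mathfrak S}:=H_{\mathfrak S(H)}$. $|H|$ denotes the number of vertices. Induced subgraphs are identified with their vertex sets. For a graph $H$, a vertex set $A\subseteq V(H)$ and a set $S\subseteq V(H)$: $\operatorname{clos}_S(A)=A\cup S\cup\{v\in V(H): v\sim w\text{ for some }w\in A\}$ and $\partial_S A=\operatorname{clos}_S(A)\setminus A$ (in particular $\partial_S\emptyset=S$). Exhausting sequence. Let $G$ be a locally finite, infinite connected graph and $S,T\subseteq V(G)$. A sequence $(G^{(n)})_{n\ge1}$ of finite induced subgraphs exhausts $G$ if: the $G^{(n)}$ are connected, $G^{(1)}\subseteq G^{(2)}\subseteq\dots\subseteq G$ and $\bigcup_n V(G^{(n)})=V(G)$; and $S\subseteq V(G^{(n)})$ for all $n$ (so $S$ is finite; $S$ is nonempty and is the set of sources of $G^{(n)}$), while $G^{(n)}$ is endowed with the target set $T^{(n)}=(T\cap V(G^{(n)}))\cup\partial_\emptyset(G\setminus G^{(n)})$, where $\partial_\emptyset(G\setminus G^{(n)})$ is the set of vertices of $G^{(n)}$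 having a neighbour in $V(G)\setminus V(G^{(n)})$. Admissible subgraphs. An induced subgraph $A$ of a finite connected graph $H$ with sources and (nonempty set of) targets is admissible if $\mathbf P[H_{\mathfrak S}=A]>0$. $\mathscr A_m(H)$ denotes the set of all admissible subgraphs of $H$ with exactly $m$ vertices. *)

(* Defs.v *)
From HB Require Import structures.
From mathcomp Require Import all_boot all_order all_algebra finmap.
From mathcomp Require Import all_classical all_reals all_analysis.

Set Implicit Arguments.
Unset Strict Implicit.
Unset Printing Implicit Defensive.

Import Order.TTheory GRing.Theory Num.Theory.
Import numFieldNormedType.Exports.

Local Open Scope fset_scope.
Local Open Scope classical_set_scope.
Local Open Scope ring_scope.

(* A simple graph is a symmetric irreflexive relation e on V.  Subgraphs are
   always induced and are identified with their vertex sets; finite ones are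
   elements of {fset V}. *)
Section Graphs.
Variables (V : choiceType) (e : rel V).

Definition linked (X : set V) (x y : V) : Prop :=
  exists p : seq V, [/\ path e x p, last x p = y & [set` x :: p] `<=` X].

Definition connected_graph (X : set V) : Prop :=
  forall x y, X x -> X y -> linked X x y.

Definition locally_finite : Prop := forall v, finite_set [set w | e v w].

(* closure and boundary of A in the subgraph with vertex set H *)
Definition clos (H S A : set V) : set V :=
  A `|` S `|` [set v | H v /\ exists2 w, A w & e v w].

Definition bdry (H S A : set V) : set V := clos H S A `\` A.

(* The sequence is indexed from 0, so that G_ n is $G^{(n+1)}$. *)
Record exhausts (S : set V) (G_ : nat -> {fset V}) : Prop := Exhausts {
  exhausts_connected : forall n, connected_graph [set` G_ n];
  exhausts_mono : forall n, [set` G_ n] `<=` [set` G_ n.+1];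
  exhausts_union : \bigcup_n [set` G_ n] = setT;
  exhausts_sources : forall n, S `<=` [set` G_ n] }.

(* target set of a finite induced subgraph K of the infinite graph *)
Definition targets (T : set V) (K : {fset V}) : set V :=
  (T `&` [set` K]) `|` bdry setT set0 (~` [set` K]).

End Graphs.

Section Cutting.
Variables (R : realType) (V : choiceType) (e : rel V) (S : set V).

(* one step: delete v, then discard the components without a source *)
Definition cut_step (X : {fset V}) (v : V) : {fset V} :=
  [fset w in (X `\ v)%fset |
    `[< exists2 s, S s & linked e [set` (X `\ v)%fset] s w >]]%fset.

(* An outcome is the sequence of the chosen vertices v_1, v_2, ..., and
   state H s i is then the graph H_i. *)
Definition state (H : {fset V}) (s : seq V) (i : nat) : {fset V} :=
  foldl cut_step H (take i s).

(* Probability of the outcome s: the product of the 1 / |H_(i-1)| if s is a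
   complete run (each v_i lies in H_(i-1) and the last graph is empty), and 0
   otherwise. *)
Fixpoint run_weight (H : {fset V}) (s : seq V) : R :=
  match s with
  | [::] => (H == fset0)%:R
  | v :: s' => (v \in H)%:R / #|` H|%:R * run_weight (cut_step H v) s'
  end.

Definition cut_prob (H : {fset V}) (E : set (seq V)) : \bar R :=
  \esum_(s in E) (run_weight H s)%:E.

Variable T : set V.

(* least i such that H_i contains no target; on a complete run the graph of
   index size s is empty, so the range of the search is large enough *)
Definition sep_number (H : {fset V}) (s : seq V) : nat :=
  find (fun i => `[< [set` state H s i] `&` T = set0 >]) (iota 0 (size s).+1).

Definition sep_graph (H : {fset V}) (s : seq V) : {fset V} :=
  state H s (sep_number H s).

Definition admissible (H A : {fset V}) : Prop :=
  (0 < cut_prob H [set s | sep_graph H s = A])%E.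

Definition admissibles (m : nat) (H : {fset V}) : {fset {fset V}} :=
  [fset A in fpowerset H | (#|` A| == m) && `[< admissible H A >]]%fset.

End Cutting.

(* |\partial_S A|, the boundary being taken in H *)
Definition bdry_card (V : choiceType) (e : rel V) (S : set V)
    (H A : {fset V}) : nat :=
  #|` fset_set (bdry e [set` H] S [set` A])|.

Section Sums.
Variables (R : realType) (V : choiceType) (e : rel V) (S T : set V).
Variable G_ : nat -> {fset V}.

Definition bdry_sum (m n : nat) : nat :=
  (\sum_(A <- admissibles R e S (targets e T (G_ n)) m (G_ n))
     bdry_card e S (G_ n) A)%N.

Definition bdry_sum_lim (m : nat) : R := limn (fun n => (bdry_sum m n)%:R : R).

End Sums.

Section PowerSeries.
Variable R : realType.

Definition conv_radius (u : R^nat) : \bar R :=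
  ereal_sup [set `|x|%:E | x in [set x : R | cvgn (pseries u x)]].

Definition series_from (L : nat) (a : R^nat) : R^nat :=
  fun m => if (L <= m)%N then a m else 0.

(* The sum of the series for a >= 0 and x >= 0, possibly +oo at the boundary
   of the disk of convergence. *)
Definition power_sum (L : nat) (a : R^nat) (x : R) : \bar R :=
  (\sum_(L <= m <oo) (a m * x ^+ m)%:E)%E.

End PowerSeries.

(* Main.v *)
Require Import Defs.
From HB Require Import structures.
From mathcomp Require Import all_boot all_order all_algebra finmap.
From mathcomp Require Import all_classical all_reals all_analysis.
From mathcomp Require Import measurable_realfun lra ring.

Set Implicit Arguments.
Unset Strict Implicit.
Unset Printing Implicit Defensive.

Import Order.TTheory GRing.Theory Num.Theory.
Import numFieldNormedType.Exports.

Local Open Scope classical_set_scope.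
Local Open Scope ring_scope.

(** Give every vertex an independent uniform clock.  A finite set [A] that is
   joined to the sources inside itself can only be visited by the cutting
   process if all of its [d] boundary vertices are deleted before any of its
   [m] vertices, and this has probability [1 / 'C(d + m, m)], which equals
   [d * \int_0^1 x ^ m (1 - x) ^ (d - 1)].  If [d >= b m + 1] this is at most
   [d] times the integral [c_m] of [(x (1 - x) ^ b) ^ m].  Summing over the
   admissible sets of size at least [M] bounds the tail of the separation size
   by the tail of the series [\sum_m a_m c_m], which converges because its sum
   is the integral of [f (x (1 - x) ^ b)].

   The sum that arises for the graph [G_ n] involves [a_(m,n)], and not its
   limit [a_m].  These are not comparable: if the complement of [G_ n] has a
   bounded component, then the vertices around this hole are targets of [G_ n]
   but need not be targets of later graphs, so a set admissible in [G_ n] may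
   stop being admissible.  Hence [G_ n] is first replaced by a finite set [F] that
   contains it and whose complement has no bounded component
   ([filled_exists]).
   - Running both processes with the same clocks, the one on [F] separates no
     later than the one on [G_ n]: when [G_ n] has separated, its current graph
     touches nothing outside [G_ n], so it is also the current graph of [F] and
     has no target there ([stop_enlarge]).  The separation graph of [G_ n] is
     thus contained in that of [F] ([sep_prob_coupling]).
   - What is admissible in [F] is admissible in [G_ k] for all large [k],
     because a vertex where [F] can be left is joined to points outside [G_ k]
     in the complement of [F] ([transfer_to_exhaustion]).
   - The same comparison in both directions, with [F] large enough to contain
     all clusters of size [m], shows that [a_(m,k)] is eventually constant in
     [k], hence equal to [a_m] ([bdry_sum_near]).
   So the sum for [F] is bounded by [a_m] ([filled_cluster_sum_le]).

   Clocks do not appear in the formal argument.  All statements about the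
   process are proved by induction on the size of the current graph, through
   the recursion that averages over the next deleted vertex
   ([sep_prob_step]). *)

(** * The part of a graph joined to the sources *)

Section Linked.
Variables (V : choiceType) (e : rel V).
Implicit Types X Y : set V.

Lemma linked_refl X x : X x -> linked e X x x.
Proof. by move=> Xx; exists [::]; split=> // y /=; rewrite inE => /eqP->. Qed.

Lemma linked_step X x y z : linked e X x y -> e y z -> X z -> linked e X x z.
Proof.
move=> [p [ep <- pX]] eyz Xz; exists (rcons p z); split.
- by rewrite rcons_path ep.
- by rewrite last_rcons.
- move=> u /=; rewrite -rcons_cons mem_rcons inE => /orP[/eqP->//|up].
  exact: pX.
Qed.

(** Reasoning about paths from a fixed point reduces to this principle. *)
Lemma linked_ind X x (Q : V -> Prop) : (X x -> Q x) ->
    (forall y z, Q y -> e y z -> X z -> Q z) ->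
  forall y, linked e X x y -> Q y.
Proof.
move=> Qx Qe y [p [ep <- pX]]; have {}Qx : Q x.
  by apply: Qx; apply: pX; rewrite /= mem_head.
have {}pX u : u \in p -> X u by move=> up; apply: pX; rewrite /= inE up orbT.
elim: p x ep Qx pX => //= z p IH x /andP[exz ep] Qx pX.
apply: IH => //; first by apply: Qe Qx exz _; apply: pX; rewrite mem_head.
by move=> u up; apply: pX; rewrite inE up orbT.
Qed.

Lemma linked_in X x y : linked e X x y -> X y.
Proof. exact: linked_ind. Qed.

Lemma linked_source X x y : linked e X x y -> X x.
Proof. by move=> [p [_ _ pX]]; apply: pX; rewrite /= mem_head. Qed.

Lemma linked_trans X x y z : linked e X x y -> linked e X y z -> linked e X x z.
Proof.
by move=> xy; apply: linked_ind => // u w xu euw Xw; apply: linked_step xu euw Xw.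
Qed.

Lemma linked_sym X x y : symmetric e -> linked e X x y -> linked e X y x.
Proof.
move=> e_sym xy; have Xx := linked_source xy; move: y xy.
apply: (@linked_ind _ x (fun y => linked e X y x)) => [_|y z yx eyz Xz].
  exact: linked_refl.
have Xy := linked_source yx; apply: linked_trans (_ : linked e X z y) yx.
apply: (@linked_step _ _ z); last exact: Xy.
  exact: linked_refl.
by rewrite e_sym.
Qed.

End Linked.

Section Reach.
Variables (V : choiceType) (e : rel V) (S : set V).
Implicit Types X Y K : {fset V}.

Definition reach X : {fset V} :=
  [fset w in X | `[< exists2 s, S s & linked e [set` X] s w >]]%fset.

Lemma cut_stepE X v : cut_step e S X v = reach (X `\ v)%fset.
Proof. by []. Qed.

Lemma in_reach X w :
  w \in reach X <-> exists2 s, S s & linked e [set` X] s w.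
Proof.
rewrite /reach !inE /=; split=> [/andP[_ /asboolP]//|h].
by apply/andP; split; [case: h => s _ /linked_in | apply/asboolP].
Qed.

Lemma reach_sub X : (reach X `<=` X)%fset.
Proof. by apply/fsubsetP => w /in_reach[s _ /linked_in]. Qed.

Lemma reach_source X s : S s -> s \in X -> s \in reach X.
Proof. by move=> Ss sX; apply/in_reach; exists s => //; exact: linked_refl. Qed.

Lemma reach_step X x y : x \in reach X -> e x y -> y \in X -> y \in reach X.
Proof.
move=> /in_reach[s Ss sx] exy yX; apply/in_reach; exists s => //.
exact: linked_step sx exy _.
Qed.

(** [reach X] is the least set that contains the sources of [X] and is closed
   under adjacency in [X]; inclusions between such sets follow from this. *)
Lemma reach_min X (Q : V -> Prop) : (forall s, S s -> s \in X -> Q s) ->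
    (forall x y, Q x -> e x y -> y \in X -> Q y) ->
  forall x, x \in reach X -> Q x.
Proof.
move=> QS Qe x /in_reach[s Ss]; apply: linked_ind => //; exact: QS.
Qed.

Lemma reach_subset X Y : (X `<=` Y)%fset -> (reach X `<=` reach Y)%fset.
Proof.
move=> /fsubsetP XY; apply/fsubsetP; apply: reach_min => [s Ss /XY|x y xY exy /XY].
  exact: reach_source.
exact: reach_step xY exy.
Qed.

Lemma reach_idem X : reach (reach X) = reach X.
Proof.
apply/eqP; rewrite eqEfsubset reach_sub; apply/fsubsetP => x xX.
suff [] : x \in reach X /\ x \in reach (reach X) by [].
move: x xX; apply: reach_min => [s Ss sX|x y [xX xXX] exy yX].
  have h := reach_source Ss sX; split=> //; exact: reach_source.
have h := reach_step xX exy yX; split=> //; exact: reach_step xXX exy h.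
Qed.

(** The current graph depends only on the set of deleted vertices.  This is
   what allows processes on different graphs to be compared: they are run with
   the same set [W] of deletions. *)
Lemma cut_reach X W v :
  cut_step e S (reach (X `\` W)%fset) v = reach (X `\` (v |` W))%fset.
Proof.
rewrite cut_stepE; apply/eqP; rewrite eqEfsubset; apply/andP; split.
  apply: reach_subset; apply/fsubsetP => x.
  rewrite !inE => /and3P[xv /andP[xW xX] _]; by rewrite negb_or xv xW xX.
apply/fsubsetP => x xX.
have sub : (reach (X `\` (v |` W))%fset `<=` reach (X `\` W)%fset)%fset.
  apply: reach_subset; apply: fsetDS; exact: fsubsetU1.
have nv y : y \in reach (X `\` (v |` W))%fset -> y != v.
  by move=> /(fsubsetP (reach_sub _)); rewrite !inE negb_or -andbA => /andP[].
suff [] : x \in reach (X `\` (v |` W))%fset /\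
    x \in reach (reach (X `\` W)%fset `\ v)%fset by [].
move: x xX; apply: reach_min => [s Ss sX|x y [xX xXX] exy yX].
  have h := reach_source Ss sX; split=> //; apply: reach_source => //.
  by rewrite in_fsetD1 nv//= (fsubsetP sub).
have h := reach_step xX exy yX; split=> //; apply: reach_step xXX exy _.
by rewrite in_fsetD1 nv//= (fsubsetP sub).
Qed.

Lemma reachD1_notin X v : v \notin reach X -> reach (X `\ v)%fset = reach X.
Proof.
move=> vX; apply/eqP; rewrite eqEfsubset reach_subset ?fsubD1set//=.
  by rewrite -{1}(reach_idem X) reach_subset// fsubsetD1 reach_sub.
Qed.

Lemma cut_step_sub X v : (cut_step e S X v `<=` X `\ v)%fset.
Proof. exact: reach_sub. Qed.

Lemma card_cut_step X v : v \in X -> (#|` cut_step e S X v| < #|` X|)%N.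
Proof.
move=> vX; rewrite [ltnRHS](cardfsD1 v) vX add1n ltnS.
exact/fsubset_leq_card/cut_step_sub.
Qed.

End Reach.

(** * The law of the separation graph *)

Lemma esumZl (R : realType) (I : choiceType) (D : set I) (a : I -> \bar R)
    (r : R) : 0 <= r -> (forall i, 0 <= a i)%E ->
  (\esum_(i in D) (r%:E * a i) = r%:E * \esum_(i in D) a i)%E.
Proof.
move=> r0 a0; rewrite /esum -ereal_supZl//; last first.
  apply/set0P; exists (\sum_(i \in set0) a i)%E; exists set0 => //.
  exact: fsets_set0.
by rewrite image_comp; congr ereal_sup; apply: eq_imagel => A _; rewrite /= ge0_mule_fsumr.
Qed.

Section CutProb.
Variables (R : realType) (V : choiceType) (e : rel V) (S : set V).
Implicit Types (H : {fset V}) (E : set (seq V)) (phi : pred {fset V}).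

Local Notation weight := (run_weight R e S).
Local Notation cprob := (cut_prob R e S).

Lemma run_weight_ge0 H s : 0 <= weight H s.
Proof.
elim: s H => [|v s IH] H /=; first by rewrite ler0n.
by rewrite mulr_ge0 ?divr_ge0 ?ler0n.
Qed.

Lemma cut_prob_ge0 H E : (0 <= cprob H E)%E.
Proof. by apply: esum_ge0 => s _; rewrite lee_fin run_weight_ge0. Qed.

Lemma cut_prob_le H E E' : E `<=` E' -> (cprob H E <= cprob H E')%E.
Proof.
move=> EE'; rewrite /cut_prob esum_mkcond [leRHS]esum_mkcond.
apply: le_esum => s _; case: ifPn => [/set_mem/EE'/mem_set->//|_].
by case: ifPn => // _; rewrite lee_fin run_weight_ge0.
Qed.

Lemma cut_prob_fset0 : cprob fset0 setT = 1%E.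
Proof.
rewrite /cut_prob (esumID [set [::]]) => [|s _]; last first.
  by rewrite lee_fin run_weight_ge0.
rewrite setTI esum_set1 ?lee_fin ?run_weight_ge0//.
rewrite (_ : weight fset0 [::] = 1) ?[LHS]/= ?eqxx//.
by rewrite esum1 ?adde0// => -[[_ /(_ erefl)//]|v s _]; rewrite /= !mul0r.
Qed.

(** Conditioning on the first deleted vertex: the runs with nonzero weight are
   the [v :: s] with [v] in [H], so the sum over runs is a sum over pairs. *)
Lemma cut_prob_step H E : H != fset0 ->
  (cprob H E =
   \sum_(v <- H) (#|` H|%:R^-1)%:E * cprob (cut_step e S H v) [set s | E (v :: s)])%E.
Proof.
move=> H0; pose J v := [set s | E (v :: s)].
rewrite {1}/cut_prob (esumID [set s | exists2 v, v \in H & exists s', s = v :: s']);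
  last by move=> s _; rewrite lee_fin run_weight_ge0.
rewrite [X in (_ + X)%E]esum1 ?adde0; last first.
  move=> [|v s] [_ /= nH]; first by rewrite (negbTE H0).
  case: (boolP (v \in H)) => [vH|_]; last by rewrite mul0r mul0r.
  by exfalso; apply: nH; exists v => //; exists s.
rewrite (reindex_esum ([set` H] `*`` J) _ (fun p => p.1 :: p.2)); last first.
  split.
  - by move=> [v s] [/= vH Es]; split=> //; exists v => //; exists s.
  - by move=> [v s] [w t] _ _ /= [-> ->].
  - move=> s [Es [v vH [s' ss']]]; exists (v, s') => //=.
    by split=> //=; rewrite /J /= -ss'.
rewrite -(@esum_esum _ _ _ [set` H] J (fun v s => (weight H (v :: s))%:E));
  last by move=> v s _ _; rewrite lee_fin run_weight_ge0.
rewrite esum_fset//; last first.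
  by move=> v _; apply: esum_ge0 => s _; rewrite lee_fin run_weight_ge0.
rewrite fsbig_finite//= set_fsetK big_seq [in RHS]big_seq; apply: eq_bigr => v vH.
rewrite /cut_prob -esumZl ?invr_ge0//; last first.
  by move=> s; rewrite lee_fin run_weight_ge0.
by apply: eq_esum => s _; rewrite /= vH mul1r EFinM.
Qed.

Lemma sum_const_fset (H : {fset V}) (r : R) : \sum_(v <- H) r = #|` H|%:R * r.
Proof. by rewrite big_const_seq count_predT iter_addr_0 mulr_natl. Qed.

Lemma cut_prob_setT H : cprob H setT = 1%E.
Proof.
have [n] := ubnP #|` H|; elim: n H => // n IH H; rewrite ltnS => Hn.
have [->|H0] := eqVneq H fset0; first exact: cut_prob_fset0.
rewrite cut_prob_step// big_seq.
under eq_bigr => v vH.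
  rewrite (_ : [set s | _] = setT)// IH ?mule1; last first.
    exact: leq_trans (card_cut_step _ _ vH) Hn.
  over.
rewrite -big_seq sumEFin sum_const_fset divff// pnatr_eq0 cardfs_eq0//.
Qed.

Lemma cut_prob_le1 H E : (cprob H E <= 1)%E.
Proof. by rewrite -(cut_prob_setT H); exact: cut_prob_le. Qed.

Variable T : set V.

(** The predicate is arbitrary so that one recursion serves both the tail of the
   size of the separation graph and the probability that it is a given set. *)
Definition sep_prob H phi : R := fine (cprob H [set s | phi (sep_graph e S T H s)]).

Lemma sep_probE H phi :
  cprob H [set s | phi (sep_graph e S T H s)] = (sep_prob H phi)%:E.
Proof.
rewrite fineK// ge0_fin_numE ?cut_prob_ge0//.
exact: le_lt_trans (cut_prob_le1 _ _) (ltry 1).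
Qed.

Lemma sep_prob_ge0 H phi : 0 <= sep_prob H phi.
Proof. by rewrite -lee_fin -sep_probE cut_prob_ge0. Qed.

Lemma sep_prob_le1 H phi : sep_prob H phi <= 1.
Proof. by rewrite -lee_fin -sep_probE cut_prob_le1. Qed.

Lemma sep_graph_stop H s : [set` H] `&` T = set0 -> sep_graph e S T H s = H.
Proof.
move=> HT; rewrite /sep_graph /sep_number /= asboolT /=; last first.
  by rewrite /state take0.
by rewrite /state take0.
Qed.

(** The search for the separation index does not stop at 0, so it is the search
   along the rest of the run, shifted by one. *)
Lemma sep_graph_step H v s : [set` H] `&` T <> set0 ->
  sep_graph e S T H (v :: s) = sep_graph e S T (cut_step e S H v) s.
Proof.
move=> HT; rewrite /sep_graph /sep_number.
have -> : iota 0 (size (v :: s)).+1 = 0%N :: map succn (iota 0 (size s).+1).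
  by rewrite -(eq_map add1n) -iotaDl.
rewrite [find _ (_ :: _)]/= asboolF//= find_map.
by rewrite /state.
Qed.

Lemma sep_prob_stop H phi : [set` H] `&` T = set0 -> sep_prob H phi = (phi H)%:R.
Proof.
move=> HT; apply: EFin_inj; rewrite -sep_probE.
case: (boolP (phi H)) => pH.
  rewrite (_ : [set s | _] = setT) ?cut_prob_setT//; apply/seteqP; split=> // s _ /=.
  by rewrite sep_graph_stop.
rewrite (_ : [set s | _] = set0) ?/cut_prob ?esum_set0//.
by apply/seteqP; split=> // s /=; rewrite sep_graph_stop// (negbTE pH).
Qed.

Lemma sep_prob_step H phi : [set` H] `&` T <> set0 ->
  sep_prob H phi = #|` H|%:R^-1 * \sum_(v <- H) sep_prob (cut_step e S H v) phi.
Proof.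
move=> HT; apply: EFin_inj; rewrite -sep_probE cut_prob_step; last first.
  apply: contra_notN HT => /eqP->; apply/seteqP; split=> // x []/=.
  by rewrite inE.
rewrite mulr_sumr -sumEFin; apply: eq_bigr => v _; rewrite EFinM -sep_probE.
by congr (_ * cut_prob _ _ _ _ _)%E; apply/seteqP; split=> s /=; rewrite sep_graph_step.
Qed.

End CutProb.

(** * Visit probabilities and comparison of two processes *)

Section SepProbTheory.
Variables (R : realType) (V : choiceType) (e : rel V) (S : set V).
Implicit Types (X K A D G W : {fset V}) (phi : pred {fset V}) (T : set V).

Local Notation sprob := (sep_prob R e S).
Local Notation reach := (reach e S).
Local Notation cut := (cut_step e S).

Lemma sum_fsetI X K (F : V -> R) : (X `<=` K)%fset ->
  \sum_(v <- K) (v \in X)%:R * F v = \sum_(v <- X) F v.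
Proof.
move=> XK; rewrite -(big_fset_incl _ XK) => [|v _ /negbTE->]; last by rewrite mul0r.
by rewrite big_seq [RHS]big_seq; apply: eq_bigr => v ->; rewrite mul1r.
Qed.

(** [Q] is an invariant of the process that excludes [phi] at separation. *)
Lemma sep_prob_eq0 T (Q : {fset V} -> Prop) phi K :
    (forall X v, Q X -> v \in X -> Q (cut X v)) ->
    (forall X, Q X -> [set` X] `&` T = set0 -> ~~ phi X) ->
  Q K -> sprob T K phi = 0.
Proof.
move=> Qcut Qphi; have [n] := ubnP #|` K|; elim: n K => // n IH K.
rewrite ltnS => Kn QK; have [KT|KT] := pselect ([set` K] `&` T = set0).
  by rewrite sep_prob_stop// (negbTE (Qphi _ QK KT)).
rewrite sep_prob_step// big_seq big1 ?mulr0// => v vK.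
by apply: IH; [exact: leq_trans (card_cut_step _ _ vK) Kn | exact: Qcut].
Qed.

Lemma sep_prob_sum T phi K U : (K `<=` U)%fset ->
  sprob T K phi = \sum_(A <- fpowerset U | phi A) sprob T K (pred1 A).
Proof.
have [n] := ubnP #|` K|; elim: n K => // n IH K; rewrite ltnS => Kn KU.
have [KT|KT] := pselect ([set` K] `&` T = set0).
  rewrite sep_prob_stop//; under eq_bigr do rewrite sep_prob_stop//=.
  rewrite big_mkcond (bigD1_seq K) ?fpowersetE ?fset_uniq//= eqxx big1 ?addr0.
    by case: (phi K).
  by move=> A; rewrite eq_sym => /negbTE->; case: ifP.
rewrite sep_prob_step//; under [RHS]eq_bigr do rewrite sep_prob_step//.
rewrite -mulr_sumr exchange_big/=; congr (_ * _).
rewrite big_seq [RHS]big_seq; apply: eq_bigr => v vK.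
apply: IH; first exact: leq_trans (card_cut_step _ _ vK) Kn.
exact: fsubset_trans (fsubset_trans (cut_step_sub _ _ _ _) (fsubD1set _ _)) KU.
Qed.

(** [A] can only be visited if [D] is deleted before any vertex of [A]; the
   bound is the probability that [#|D|] given elements come first in a random
   order of [#|D| + #|A|] elements.  As long as [A] is intact, the members of
   [D] not yet deleted are in the current graph, being sources or neighbours of
   [A], so the next deletion is equally likely to be any of them. *)
Lemma sep_prob_le_bin T K A D : reach A = A -> (A `<=` K)%fset -> (D `<=` K)%fset ->
    [disjoint A & D]%fset ->
    (forall w, w \in D -> S w \/ exists2 u, u \in A & e u w) ->
  sprob T K (pred1 A) <= 'C(#|` D| + #|` A|, #|` A|)%:R^-1.
Proof.
move=> rA; have [n] := ubnP #|` K|; elim: n K D => // n IH K D.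
rewrite ltnS => Kn AK DK AD Dbd; have [D0|Dn0] := eqVneq #|` D| 0%N.
  by rewrite D0 add0n binn invr1 sep_prob_le1.
have [KT|KT] := pselect ([set` K] `&` T = set0).
  rewrite sep_prob_stop//=; case: eqP => [KA|_]; last by rewrite invr_ge0.
  case/eqP: Dn0; apply/eqP; rewrite cardfs_eq0 -fsubset0.
  apply/fsubsetP => w wD; move/fdisjointP: AD => /(_ w).
  by rewrite -KA (fsubsetP DK) // wD => /(_ isT).
rewrite sep_prob_step//.
set a := #|` A| in IH *; set d := #|` D| in Dn0 *.
(* The bound [p] solves the recursion obtained by conditioning on the next
   deletion: a vertex of [A] contributes 0 and a vertex of [D] lowers [d]. *)
pose p k : R := 'C(k + a, a)%:R^-1.
have pd : d%:R * p d.-1 = (d + a)%:R * p d.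
  have C0 k : 'C(k + a, a)%:R != 0 :> R by rewrite pnatr_eq0 -lt0n bin_gt0 leq_addl.
  apply: (mulIf (C0 d.-1)); rewrite mulfVK//; apply: (mulIf (C0 d)).
  rewrite mulrAC mulfVK// -!natrM; congr (_%:R).
  have := mul_bin_down (d + a) a; rewrite addnK => <-.
  by rewrite -[in (d + a).-1](prednK (n := d)) ?lt0n.
have K0 : 0 < #|` K|%:R :> R.
  rewrite ltr0n; apply: leq_trans (fsubset_leq_card DK); by rewrite lt0n.
rewrite mulrC ler_pdivrMr//.
have -> : 'C(d + a, a)%:R^-1 * #|` K|%:R =
    \sum_(v <- K) (p d - (v \in A)%:R * p d + (v \in D)%:R * (p d.-1 - p d)).
  rewrite big_split sumrB/= !sum_fsetI// !sum_const_fset mulrBr pd natrD.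
  by rewrite -/a -/d -/(p d); ring.
rewrite big_seq [leRHS]big_seq; apply: ler_sum => v vK.
have cutn : (#|` cut K v| < n)%N by exact: leq_trans (card_cut_step _ _ vK) Kn.
case: (boolP (v \in A)) => [vA|vA].
  have /negbTE-> : v \notin D by rewrite (fdisjointP AD).
  rewrite mul1r subrr mul0r addr0 (sep_prob_eq0 (Q := fun X => v \notin X))//.
  - move=> X w vX _; apply: contraNN vX => /(fsubsetP (cut_step_sub _ _ _ _)).
    by rewrite !inE => /andP[].
  - by move=> X vX _; apply: contraNN vX => /eqP->.
  - by apply/negP => /(fsubsetP (cut_step_sub _ _ _ _)); rewrite !inE eqxx.
have Acut : (A `<=` cut K v)%fset.
  by rewrite -rA; apply: reach_subset; rewrite fsubsetD1 AK.
have Dcut w : w \in D -> w != v -> w \in cut K v.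
  move=> wD wv; have wK : w \in (K `\ v)%fset by rewrite !inE wv (fsubsetP DK).
  case: (Dbd _ wD) => [Sw|[u uA euw]]; first exact: reach_source.
  by apply: reach_step euw wK; apply: (fsubsetP Acut).
rewrite mul0r subr0; case: (boolP (v \in D)) => [vD|vD].
  rewrite mul1r addrC subrK.
  have -> : d.-1 = #|` D `\ v|%fset by rewrite /d (cardfsD1 v) vD.
  apply: IH => //.
  - by apply/fsubsetP => w /fsetD1P[wv wD]; apply: Dcut.
  - by apply: fdisjointWr AD; apply: fsubD1set.
  - by move=> w /fsetD1P[_ /Dbd].
rewrite mul0r addr0; apply: IH => //; apply/fsubsetP => w wD; apply: Dcut => //.
by apply: contraNneq vD => <-.
Qed.

(** Both processes use the same deletions, drawn uniformly from the larger
   current graph [K]; a vertex outside the smaller one [X] leaves [X]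
   unchanged.  Such idle steps do not change the law of the separation graph.
   By [stop] the process on [X] separates no earlier than the one on [K], so
   its separation graph is contained in the other. *)
Lemma sep_prob_coupling T1 T2 G1 G2 M : (G1 `<=` G2)%fset ->
    (forall W, [set` reach (G1 `\` W)%fset] `&` T1 = set0 ->
       reach (G2 `\` W)%fset = reach (G1 `\` W)%fset /\
       [set` reach (G2 `\` W)%fset] `&` T2 = set0) ->
  forall W, sprob T1 (reach (G1 `\` W)%fset) [pred X | (M <= #|` X|)%N] <=
            sprob T2 (reach (G2 `\` W)%fset) [pred X | (M <= #|` X|)%N].
Proof.
move=> G12 stop W; set phi := [pred X | _].
have [n] := ubnP #|` reach (G2 `\` W)%fset|; elim: n W => // n IH W.
rewrite ltnS; set X := reach (G1 `\` W)%fset; set K := reach (G2 `\` W)%fset => Kn.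
have XK : (X `<=` K)%fset by apply/reach_subset/fsetSD.
have [XT|XT] := pselect ([set` X] `&` T1 = set0).
  have [KX KT] := stop _ XT; rewrite -/K -/X in KX KT.
  by rewrite !sep_prob_stop// KX.
have [KT|KT] := pselect ([set` K] `&` T2 = set0).
  rewrite (@sep_prob_stop _ _ _ _ T2)//=; case: leqP => [_|KM]; first exact: sep_prob_le1.
  rewrite (sep_prob_eq0 (Q := fun Y => (Y `<=` K)%fset))//.
  - move=> Y v YK _; apply: fsubset_trans YK.
    exact: fsubset_trans (cut_step_sub _ _ _ _) (fsubD1set _ _).
  - by move=> Y YK _ /=; rewrite -ltnNge; apply: leq_ltn_trans (fsubset_leq_card YK) KM.
have card_gt0 (Y : {fset V}) T : [set` Y] `&` T <> set0 -> 0 < #|` Y|%:R :> R.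
  move=> YT; rewrite ltr0n cardfs_gt0; apply: contra_notN YT => /eqP->.
  by apply/seteqP; split=> // x []/=; rewrite inE.
rewrite [leRHS]sep_prob_step// mulrC ler_pdivlMr ?(card_gt0 _ _ KT)//.
set f1 := sprob T1 X phi.
have -> : f1 * #|` K|%:R =
    \sum_(v <- K) (f1 + (v \in X)%:R * (sprob T1 (cut X v) phi - f1)).
  rewrite big_split/= sum_fsetI// sumrB !sum_const_fset.
  rewrite {3}/f1 sep_prob_step// mulVKf ?gt_eqF ?(card_gt0 _ _ XT)//.
  by rewrite subrr addr0 mulrC.
rewrite big_seq [leRHS]big_seq; apply: ler_sum => v vK.
have cutn : (#|` reach (G2 `\` (v |` W))%fset| < n)%N.
  by rewrite -cut_reach; apply: leq_trans (card_cut_step _ _ vK) Kn.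
rewrite /K cut_reach; apply: le_trans (IH _ cutn).
case: (boolP (v \in X)) => [vX|vX]; first by rewrite mul1r addrC subrK /X cut_reach.
by rewrite mul0r addr0 -cut_reach cut_stepE reachD1_notin reach_idem.
Qed.

(** A run on [G1] that separates at [A] can be replayed on [G2], skipping the
   vertices which are no longer present there. *)
Lemma sep_prob_transfer T1 T2 G1 G2 A :
    (forall W, (W `<=` G1)%fset -> [set` reach (G1 `\` W)%fset] `&` T1 = set0 ->
       reach (G1 `\` W)%fset = A ->
       reach (G2 `\` W)%fset = A /\ [set` A] `&` T2 = set0) ->
    (forall W, (W `<=` G1)%fset -> [set` reach (G1 `\` W)%fset] `&` T1 <> set0 ->
       [set` reach (G2 `\` W)%fset] `&` T2 <> set0) ->
  forall W, (W `<=` G1)%fset -> 0 < sprob T1 (reach (G1 `\` W)%fset) (pred1 A) ->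
            0 < sprob T2 (reach (G2 `\` W)%fset) (pred1 A).
Proof.
move=> stop go W; have [n] := ubnP #|` reach (G1 `\` W)%fset|; elim: n W => // n IH W.
rewrite ltnS; set X := reach (G1 `\` W)%fset; set K := reach (G2 `\` W)%fset.
move=> Xn WG; have [XT|XT] := pselect ([set` X] `&` T1 = set0).
  rewrite sep_prob_stop//=; have [XA _|_] := eqVneq X A; last by rewrite ltxx.
  by rewrite /K; have [-> AT] := stop _ WG XT XA; rewrite sep_prob_stop//= eqxx.
have KT := go _ WG XT; rewrite sep_prob_step//.
have [[v vX pv]|all0] :=
  pselect (exists2 v, v \in X & 0 < sprob T1 (cut X v) (pred1 A)); last first.
  rewrite big_seq big1 => [|v vX]; first by rewrite mulr0 ltxx.
  apply/eqP; rewrite eq_le sep_prob_ge0 andbT leNgt; apply/negP => pv.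
  by apply: all0; exists v.
have : 0 < sprob T2 (reach (G2 `\` (v |` W))%fset) (pred1 A).
  apply: IH.
  - by rewrite -cut_reach; apply: leq_trans (card_cut_step _ _ vX) Xn.
  - rewrite fsubUset WG fsub1set andbT.
    by move/(fsubsetP (reach_sub _ _ _)): vX; rewrite inE => /andP[].
  - by rewrite -cut_reach.
rewrite -cut_reach -/K; case: (boolP (v \in K)) => [vK pv' _|vK]; last first.
  by rewrite cut_stepE reachD1_notin reach_idem.
rewrite sep_prob_step// mulr_gt0//.
  rewrite invr_gt0 ltr0n cardfs_gt0; apply: contraTneq vK => ->; by rewrite inE.
rewrite (big_fsetD1 v)//= ltr_pwDl// sumr_ge0// => w _; exact: sep_prob_ge0.
Qed.

End SepProbTheory.

(** * Targets along an exhaustion *)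

Section Targets.
Variables (R : realType) (V : choiceType) (e : rel V) (S T : set V).
Hypothesis e_sym : symmetric e.
Implicit Types (A X F G W : {fset V}).

Local Notation reach := (reach e S).
Local Notation targets := (targets e T).
Local Notation sprob := (sep_prob R e S).

Lemma no_targetsP X G : (X `<=` G)%fset ->
  [set` X] `&` targets G = set0 <->
  (forall x, x \in X -> ~ T x /\ forall y, e x y -> y \in G).
Proof.
move=> XG; split=> [XT x xX|XT].
  have nT : ~ targets G x by move=> xT; have : set0 x by rewrite -XT.
  split=> [Tx|y exy]; first by apply: nT; left; split=> //; exact: (fsubsetP XG).
  apply: contrapT => yG; apply: nT; right; split.
    by right; split=> //; exists y.
  by move=> /=; apply; exact: (fsubsetP XG).
apply/seteqP; split=> // x [/= /XT[nT nb]] [[//]|].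
by move=> [[[xG|//]|[_ [y /= yG /nb]]]] // nxG; apply: nxG.
Qed.

(** A current graph without targets touches nothing outside [G1], so it is
   already cut off in [G2], and it contains no target of [G2] either. *)
Lemma stop_enlarge G1 G2 W : (G1 `<=` G2)%fset -> S `<=` [set` G1] ->
    [set` reach (G1 `\` W)%fset] `&` targets G1 = set0 ->
  reach (G2 `\` W)%fset = reach (G1 `\` W)%fset /\
  [set` reach (G2 `\` W)%fset] `&` targets G2 = set0.
Proof.
move=> G12 SG; have sub G := fsubset_trans (reach_sub e S (G `\` W)%fset) (fsubsetDl _ _).
move=> /(no_targetsP (sub _)) nT.
suff eqr : reach (G2 `\` W)%fset = reach (G1 `\` W)%fset.
  split=> //; apply/(no_targetsP (sub _)) => x; rewrite eqr => /nT[nTx nb].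
  by split=> // y /nb /(fsubsetP G12).
apply/eqP; rewrite eqEfsubset [X in _ && X]reach_subset ?fsetSD// andbT.
apply/fsubsetP; apply: reach_min => [s Ss|x y xX exy].
  rewrite inE => /andP[sW _]; apply: reach_source => //.
  by rewrite inE sW; exact: SG.
have [_ /(_ _ exy) yG] := nT _ xX.
by rewrite inE => /andP[yW _]; apply: reach_step xX exy _; rewrite inE yW.
Qed.

Lemma sep_prob_gt0 (T' : set V) K A : reach K = K -> 0 < sprob T' K (pred1 A) ->
  [/\ reach A = A, (A `<=` K)%fset & [set` A] `&` T' = set0].
Proof.
move=> rK pA; apply: contrapT => nA; move: pA; apply/negP; rewrite -leNgt.
rewrite (@sep_prob_eq0 _ _ _ _ _ (fun X => reach X = X /\ (X `<=` K)%fset))//.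
- move=> X v [rX XK] vX; rewrite cut_stepE reach_idem; split=> //.
  by apply: fsubset_trans XK; apply: fsubset_trans (reach_sub _ _ _) (fsubD1set _ _).
- by move=> X [rX XK] XT; apply/negP => /eqP XA; apply: nA; rewrite -XA.
Qed.

Lemma in_admissibles m G A : reach G = G ->
  A \in admissibles R e S (targets G) m G <->
  #|` A| = m /\ 0 < sprob (targets G) G (pred1 A).
Proof.
move=> rG.
have admE : admissible R e S (targets G) G A <-> 0 < sprob (targets G) G (pred1 A).
  rewrite -lte_fin -sep_probE /admissible (_ : [set s | _] =
    [set s | pred1 A (sep_graph e S (targets G) G s)])//.
  by apply/seteqP; split=> s /= /eqP.
rewrite /admissibles !inE /=; split=> [/and3P[_ /eqP-> /asboolP/admE]//|[Am pA]].
apply/and3P; split; [|by rewrite Am|exact/asboolP/admE].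
by rewrite fpowersetE; have [] := sep_prob_gt0 rG pA.
Qed.

(** The boundary no longer depends on the ambient graph once this contains all
   neighbours of [A]. *)
Lemma bdry_local G A : (forall x y, x \in A -> e x y -> y \in G) ->
  bdry e [set` G] S [set` A] = bdry e setT S [set` A].
Proof.
move=> nb; apply/seteqP; split=> v [[[Av|Sv]|[Gv [w Aw evw]]] nAv]; split=> //.
- by left; right.
- by right; split=> //; exists w.
- by left; right.
- by right; split; [apply: nb Aw _; rewrite e_sym | exists w].
Qed.

End Targets.

Section Exhaustion.
Variables (R : realType) (V : choiceType) (e : rel V) (S T : set V).
Variable G_ : nat -> {fset V}.
Hypotheses (e_sym : symmetric e) (e_lf : locally_finite e).
Hypotheses (e_conn : connected_graph e [set: V]).
Hypotheses (S_n0 : S !=set0) (G_exh : exhausts e S G_).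
Implicit Types (A X F W : {fset V}).

Local Notation reach := (reach e S).
Local Notation targets := (targets e T).
Local Notation sprob := (sep_prob R e S).

Lemma exhausts_le m n : (m <= n)%N -> (G_ m `<=` G_ n)%fset.
Proof.
move=> /subnK<-; elim: (n - m)%N => [|k IH]; first exact: fsubset_refl.
apply: fsubset_trans IH _; apply/fsubsetP => x; exact: (exhausts_mono G_exh).
Qed.

Lemma reach_exhausts n : reach (G_ n) = G_ n.
Proof.
apply/eqP; rewrite eqEfsubset reach_sub; apply/fsubsetP => x xG.
have [s Ss] := S_n0; apply/in_reach; exists s => //.
by apply: (exhausts_connected G_exh) => //; exact: (exhausts_sources G_exh).
Qed.

Lemma near_all (I : eqType) (s : seq I) (P : I -> nat -> Prop) :
    (forall x, x \in s -> \forall n \near \oo, P x n) ->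
  \forall n \near \oo, forall x, x \in s -> P x n.
Proof.
elim: s => [_|x s IH Ps]; first by apply: nearW => n x; rewrite in_nil.
have := Ps x (mem_head _ _); have : \forall n \near \oo, forall y, y \in s -> P y n.
  by apply: IH => y ys; apply: Ps; rewrite inE ys orbT.
apply: filterS2 => n Psn Pxn y; rewrite inE => /orP[/eqP->//|]; exact: Psn.
Qed.

Lemma near_exhausts X : \forall n \near \oo, (X `<=` G_ n)%fset.
Proof.
have : \forall n \near \oo, forall x, x \in X -> x \in G_ n.
  apply: near_all => x _; have : (\bigcup_n [set` G_ n]) x.
    by rewrite (exhausts_union G_exh).
  by move=> [n _ /= xn]; exists n => // k /= /exhausts_le /fsubsetP; apply.
by apply: filterS => n h; apply/fsubsetP.
Qed.

Lemma near_neighbours X :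
  \forall n \near \oo, forall x y, x \in X -> e x y -> y \in G_ n.
Proof.
have : \forall n \near \oo, forall x, x \in X -> forall y, e x y -> y \in G_ n.
  apply: near_all => x _; apply: filterS (near_exhausts (fset_set [set w | e x w])).
  move=> n /fsubsetP sub y exy; apply: sub; rewrite in_fset_set; last exact: e_lf.
  by rewrite inE.
by apply: filterS => n h x y /h; apply.
Qed.

Lemma near_paths k : \forall n \near \oo, forall s p,
  S s -> path e s p -> (size p <= k)%N -> last s p \in G_ n.
Proof.
elim: k => [|k [N _ IH]].
  by apply: nearW => n s p Ss _; rewrite leqn0 => /nilP->; exact: (exhausts_sources G_exh).
apply: filterS2 (near_exhausts (G_ N)) (near_neighbours (G_ N)) => n /fsubsetP sub nb s.
elim/last_ind => [|p y _] Ss; first by move=> *; apply: (exhausts_sources G_exh).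
rewrite rcons_path size_rcons last_rcons ltnS => /andP[ep ey] pk.
by apply: nb ey; apply: IH => /=.
Qed.

(** A cluster of size [m] lies within graph distance [m] of the sources, and by
   local finiteness this ball is finite. *)
Lemma near_clusters m : \forall n \near \oo, forall A, reach A = A ->
  #|` A| = m -> (A `<=` G_ n)%fset.
Proof.
apply: filterS (near_paths m) => n sub A rA Am; apply/fsubsetP => x.
rewrite -rA => /in_reach[s Ss [p [ep <- pA]]].
case/shortenP: ep pA => q eq uq qp pA; apply: sub => //.
rewrite -ltnS -Am ltnW// ltnS; apply: (@leq_trans (size (s :: q))) => //.
apply: uniq_leq_size => // y; rewrite inE => yq; apply: pA.
by move: yq => /orP[/eqP->|/qp yp]; rewrite /= inE ?eqxx// yp orbT.
Qed.

(** Since the [G_ n] exhaust the graph, this says that no component of the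
   complement of [F] is bounded. *)
Definition filled F :=
  forall y, y \notin F -> forall n, exists2 z, z \notin G_ n & linked e (~` [set` F]) y z.

(** Add to [X] the bounded components of its complement.  By connectivity each
   of them contains a neighbour of [X]; there are finitely many of these, so
   one [G_ N] contains all bounded components. *)
Lemma filled_exists X x0 : x0 \in X -> exists2 F, (X `<=` F)%fset & filled F.
Proof.
move=> x0X; pose unb y := forall n, exists2 z, z \notin G_ n & linked e (~` [set` X]) y z.
have bnd y : ~ unb y -> \forall n \near \oo, forall z, linked e (~` [set` X]) y z -> z \in G_ n.
  move=> /existsNP[n nn]; exists n => // k /= nk z yz.
  apply: (fsubsetP (exhausts_le nk)); apply: contrapT => /negP zn; apply: nn.
  by exists z.
have [N0 _ /(_ N0 (leqnn _)) nb] := near_neighbours X.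
have [N _ /(_ N (leqnn _)) bN] : \forall n \near \oo, forall y, y \in G_ N0 ->
    ~ unb y -> forall z, linked e (~` [set` X]) y z -> z \in G_ n.
  apply: near_all => y _; have [uy|/bnd] := pselect (unb y); first exact: nearW.
  by apply: filterS => n h _.
pose F := (X `|` [fset z in G_ N | ~~ `[< unb z >]])%fset.
have inF z : z \notin X -> ~ unb z -> z \in F.
  move=> zX nz; rewrite !inE (negbTE zX) /=; apply/andP; split; last exact/asboolPn.
  have : z \in X \/ exists y, [/\ y \in G_ N0, y \notin X & linked e (~` [set` X]) y z].
    have : linked e setT x0 z by apply: e_conn.
    move: (z); apply: linked_ind => [_|u w IH euw _]; first by left.
    have [wX|wX] := boolP (w \in X); [by left | right].
    have wX' : (~` [set` X]) w by apply/negP.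
    case: IH => [uX|[y [yN yX yu]]].
      by exists w; split=> //; [exact: nb uX euw | exact: linked_refl].
    by exists y; split=> //; apply: linked_step yu euw _.
  case=> [|[y [yN yX yz]]]; first by rewrite (negbTE zX).
  apply: bN yN _ _ (yz) => uy; apply: nz => n; have [z' z'n yz'] := uy n.
  by exists z' => //; apply: linked_trans _ yz'; exact: linked_sym.
exists F; first exact: fsubsetUl.
move=> y yF n; have yX : y \notin X by apply: contraNN yF; rewrite inE => ->.
have : unb y by apply: contrapT => /(inF _ yX); rewrite (negbTE yF).
move=> uy; have [z zn yz] := uy n; exists z => //.
suff [] : linked e (~` [set` F]) y z /\ linked e (~` [set` X]) y z by [].
move: z yz {zn}; apply: linked_ind => [yX'|u w [yuF yu] euw wX].
  by split; apply: linked_refl => //; exact/negP.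
have yw := linked_step yu euw wX; split=> //; apply: linked_step yuF euw _.
rewrite /= !inE => /orP[//|/andP[_ /asboolPn]]; apply=> k.
by have [z' z'k yz'] := uy k; exists z' => //; apply: linked_trans yz'; exact: linked_sym.
Qed.

Local Notation adm m n := (admissibles R e S (targets (G_ n)) m (G_ n)).

(** From a vertex where [F] can be left, the complement of [F] leads to a point
   outside [G_ N] without meeting [W]; the walk meets a target of [G_ N] at the
   latest where it leaves [G_ N]. *)
Lemma filled_hits_target F N W : filled F -> (F `<=` G_ N)%fset -> (W `<=` F)%fset ->
  [set` reach (F `\` W)%fset] `&` targets F <> set0 ->
  [set` reach (G_ N `\` W)%fset] `&` targets (G_ N) <> set0.
Proof.
move=> fF FN WF hit; apply: contra_not hit.
have sub (G : {fset V}) := fsubset_trans (reach_sub e S (G `\` W)%fset) (fsubsetDl _ _).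
move=> /(no_targetsP _ _ (sub _)) nT; apply/(no_targetsP _ _ (sub _)) => x xF.
have xN : x \in reach (G_ N `\` W)%fset.
  by apply: (fsubsetP (reach_subset _ _ _)) xF; exact: fsetSD.
have [nTx nb] := nT _ xN; split=> // y exy; apply: contrapT => /negP yF.
have nW z : z \notin F -> z \notin W by apply/contraNN/fsubsetP.
have [z zN yz] := fF _ yF N; move/negP: zN; apply.
apply: (fsubsetP (sub _)); move: z yz; apply: linked_ind => [_|u z uN euz /= /negP zF].
  by apply: reach_step xN (exy) _; rewrite inE nW//= nb.
have [_ /(_ _ euz) zN] := nT _ uN.
  by apply: reach_step uN euz _; rewrite inE nW.
Qed.

Lemma transfer_to_exhaustion F N A : filled F -> S `<=` [set` F] ->
    (F `<=` G_ N)%fset ->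
  0 < sprob (targets F) (reach F) (pred1 A) ->
  0 < sprob (targets (G_ N)) (G_ N) (pred1 A).
Proof.
move=> fF SF FN.
have := @sep_prob_transfer R _ e S (targets F) (targets (G_ N)) F (G_ N) A _ _ fset0.
rewrite !fsetD0 reach_exhausts; apply.
- move=> W WF FT <-; have [-> NT] := stop_enlarge FN SF FT.
  by split=> //; rewrite -NT (stop_enlarge FN SF FT).1.
- by move=> W; apply: filled_hits_target.
- exact: fsub0set.
Qed.

(** If the current graph of [F] has no target, it is by [stop_enlarge] also the
   current graph of [G_ N] and has no target there; so a target of [G_ N] is
   always accompanied by one of [F], and only the final graph [A] needs to lie
   well inside [F]. *)
Lemma transfer_from_exhaustion F N A : S `<=` [set` F] -> (F `<=` G_ N)%fset ->
    (A `<=` F)%fset -> (forall x y, x \in A -> e x y -> y \in F) ->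
  0 < sprob (targets (G_ N)) (G_ N) (pred1 A) ->
  0 < sprob (targets F) (reach F) (pred1 A).
Proof.
move=> SF FN AF nbA.
have := @sep_prob_transfer R _ e S (targets (G_ N)) (targets F) (G_ N) F A _ _ fset0.
rewrite !fsetD0 reach_exhausts; apply.
- have sub (G W : {fset V}) := fsubset_trans (reach_sub e S (G `\` W)%fset) (fsubsetDl _ _).
  move=> W _ NT NA.
  have nT : forall x, x \in A -> ~ T x.
    by move=> x xA; move/(no_targetsP _ _ (sub _ _)): NT => /(_ x); rewrite NA => /(_ xA)[].
  have AT : [set` A] `&` targets F = set0.
    by apply/(no_targetsP _ _ AF) => x xA; split=> [|y]; [exact: nT | exact: nbA].
  split=> //; apply/eqP; rewrite eqEfsubset; apply/andP; split.
    by rewrite -NA; apply/reach_subset/fsetSD.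
  apply/fsubsetP => x; rewrite -{1}NA => xN.
  suff [] : x \in A /\ x \in reach (F `\` W)%fset by [].
  move: x xN; apply: reach_min => [s Ss sN|x y [xA xF] exy yN].
    have sA : s \in A by rewrite -NA; apply: reach_source.
    split=> //; apply: reach_source => //; move: sN; rewrite !inE => /andP[-> _].
    exact: (fsubsetP AF).
  have yA : y \in A by rewrite -NA; apply: reach_step exy yN; rewrite NA.
  split=> //; apply: reach_step xF exy _; move: yN; rewrite !inE => /andP[-> _].
  exact: (fsubsetP AF).
- by move=> W _ NT; apply: contra_not NT => /(stop_enlarge FN SF)[->].
- exact: fsub0set.
Qed.

(** Choose [F] filled and containing all clusters of size [m] together with
   their neighbours.  Then the admissible sets of size [m] of every large
   [G_ n] are those of [F]. *)
Lemma bdry_sum_near m :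
  \forall n \near \oo, (bdry_sum R e S T G_ m n)%:R = bdry_sum_lim R e S T G_ m.
Proof.
suff [c Pc] : exists c, \forall n \near \oo, bdry_sum R e S T G_ m n = c.
  have Pc' : \forall n \near \oo, (bdry_sum R e S T G_ m n)%:R = c%:R :> R.
    by apply: filterS Pc => n ->.
  by rewrite /bdry_sum_lim (lim_near_cst _ Pc').
have [n1 _ /(_ _ (leqnn _)) clus] := near_clusters m.
have [n2 _ /(_ _ (leqnn _)) [sub12 nb]] :
    \forall n \near \oo, (G_ n1 `<=` G_ n)%fset /\
      forall x y, x \in G_ n1 -> e x y -> y \in G_ n.
  apply: filterS2 (near_exhausts (G_ n1)) (near_neighbours (G_ n1)).
  by move=> n h1 h2; split.
have [s Ss] := S_n0.
have [F G2F fF] := filled_exists (exhausts_sources G_exh n2 Ss).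
have SF : S `<=` [set` F].
  by move=> t /(exhausts_sources G_exh n2) /(fsubsetP G2F).
have [n3 _ sub3] := near_exhausts F.
have local A : reach A = A -> #|` A| = m ->
    (A `<=` F)%fset /\ forall x y, x \in A -> e x y -> y \in F.
  move=> rA Am; have AG := clus _ rA Am; split.
    exact: fsubset_trans AG (fsubset_trans sub12 G2F).
  by move=> x y xA exy; apply: (fsubsetP G2F); apply: nb exy; exact: (fsubsetP AG).
have admE n : (n3 <= n)%N -> forall A, A \in adm m n <->
    #|` A| = m /\ 0 < sprob (targets F) (reach F) (pred1 A).
  move=> nn A; have FN := sub3 _ nn; split.
    move=> /(in_admissibles _ _ _ _ (reach_exhausts _))[Am pA]; split=> //.
    have [rA _ _] := sep_prob_gt0 (reach_exhausts _) pA.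
    by have [AF nbA] := local _ rA Am; apply: transfer_from_exhaustion pA.
  move=> [Am pA]; apply/(in_admissibles _ _ _ _ (reach_exhausts _)); split=> //.
  exact: transfer_to_exhaustion pA.
exists (bdry_sum R e S T G_ m n3), n3 => // n /= nn; rewrite /bdry_sum.
have -> : adm m n = adm m n3.
  apply/fsetP => A; apply/idP/idP => [/(admE _ nn)|/(admE _ (leqnn _))] h.
    exact/(admE _ (leqnn _)).
  exact/(admE _ nn).
rewrite big_seq [RHS]big_seq; apply: eq_bigr => A /(admE _ (leqnn _))[Am pA].
have [rA _ _] := sep_prob_gt0 (reach_idem _ _ _) pA.
have [_ nbA] := local _ rA Am; rewrite /bdry_card.
by congr #|` fset_set _|; rewrite !bdry_local// => x y xA exy;
  apply: (fsubsetP (sub3 _ _)) (nbA _ _ xA exy) => /=.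
Qed.

Lemma bdry_sum_lim_ge0 m : 0 <= bdry_sum_lim R e S T G_ m.
Proof.
by have [n _ /(_ _ (leqnn _)) <-] := bdry_sum_near m; rewrite ler0n.
Qed.

(** All clusters of [F] counted on the left are admissible in one large [G_ n],
   where the sum of the boundary sizes has reached its limit. *)
Lemma filled_cluster_sum_le F m (c : R) : filled F -> S `<=` [set` F] -> 0 <= c ->
    (forall n A, A \in adm m n ->
       'C(bdry_card e S (G_ n) A + m, m)%:R^-1 <= (bdry_card e S (G_ n) A)%:R * c) ->
  \sum_(A <- fpowerset F | #|` A| == m) sprob (targets F) (reach F) (pred1 A) <=
  bdry_sum_lim R e S T G_ m * c.
Proof.
move=> fF SF c0 binc.
have [n _ /(_ _ (leqnn _)) [<- FG]] : \forall n \near \oo,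
    (bdry_sum R e S T G_ m n)%:R = bdry_sum_lim R e S T G_ m /\ (F `<=` G_ n)%fset.
  by apply: filterS2 (bdry_sum_near m) (near_exhausts F) => n h1 h2; split.
have rG := reach_exhausts n.
have admP A : A \in fpowerset F -> #|` A| = m ->
    sprob (targets F) (reach F) (pred1 A) <= (A \in adm m n)%:R *
      ((bdry_card e S (G_ n) A)%:R * c).
  rewrite fpowersetE => AF Am; 
  have [pA|] := ltP 0 (sprob (targets F) (reach F) (pred1 A)); last first.
    by move=> /le_trans; apply; rewrite !mulr_ge0.
  have Aadm : A \in adm m n.
    by apply/(in_admissibles _ _ _ _ rG); split=> //; apply: transfer_to_exhaustion pA.
  rewrite Aadm mul1r; apply: le_trans (binc _ _ Aadm).
  have [rA AK AT] := sep_prob_gt0 (reach_idem _ _ _) pA.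
  have SFr : S `<=` [set` reach F] by move=> s Ss; apply: reach_source => //; exact: SF.
  have finD : finite_set (bdry e [set` G_ n] S [set` A]).
    apply: (@sub_finite_set _ _ [set` G_ n]); last exact: finite_fset.
    by move=> v [[[//|/SF/(fsubsetP FG)]|[]]].
  rewrite /bdry_card -Am; apply: sep_prob_le_bin => //.
  - apply/fsubsetP => v; rewrite in_fset_set// inE => -[[[//|/SFr//]|[_ [w Aw evw]]] _].
    have wK := fsubsetP AK _ Aw; rewrite e_sym in evw.
    apply: reach_step wK (evw) _.
    by move/(no_targetsP _ _ AF): AT => /(_ _ Aw)[_ /(_ _ evw)].
  - apply/fdisjointP => v vA; rewrite in_fset_set//; apply/negP.
    by rewrite inE => -[_]; apply.
  - move=> v; rewrite in_fset_set// inE => -[[[Av|Sv]|[_ [w Aw evw]]] nAv].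
    + by case: nAv.
    + by left.
    + by right; exists w; rewrite // e_sym.
rewrite /bdry_sum natr_sum mulr_suml -(sum_fsetI (K := fpowerset (G_ n))); last first.
  apply/fsubsetP => A /(in_admissibles _ _ _ _ rG)[_ pA].
  by rewrite fpowersetE; have [] := sep_prob_gt0 rG pA.
rewrite big_mkcond -(sum_fsetI (K := fpowerset (G_ n))); last first.
  by rewrite fpowersetS.
apply: ler_sum => A _; have [AF|_] := boolP (A \in fpowerset F); last first.
  by rewrite mul0r !mulr_ge0.
by rewrite mul1r; case: eqP => [/(admP _ AF)//|_]; rewrite !mulr_ge0.
Qed.

End Exhaustion.

(** * The integral representation of the visit probability *)

Section BetaBound.
Variables (R : realType) (b : R).
Hypothesis b_gt0 : 0 < b.

Let h (x : R) := x * (1 - x) `^ b.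

Lemma measurable_integrand m : measurable_fun (`[0, 1]%classic : set R) (fun x => h x ^+ m).
Proof.
apply: measurable_funX; apply: measurable_funM => //.
by apply: (measurableT_comp (measurable_powR b)) => //; apply: measurable_funB.
Qed.

Lemma integrand_ge0 m x : x \in `[0, 1] -> 0 <= h x ^+ m.
Proof.
by rewrite in_itv => /andP[x0 _]; rewrite exprn_ge0// mulr_ge0// powR_ge0.
Qed.

Definition power_integral m : R :=
  fine (\int[lebesgue_measure]_(x in `[0%R, 1%R]) (h x ^+ m)%:E)%E.

Lemma power_integralE m : (power_integral m)%:E =
  (\int[lebesgue_measure]_(x in `[0%R, 1%R]) (h x ^+ m)%:E)%E.
Proof.
have I0 : (0 <= \int[lebesgue_measure]_(x in `[0%R, 1%R]) (h x ^+ m)%:E)%E.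
  by apply: integral_ge0 => x x01; rewrite lee_fin integrand_ge0.
rewrite fineK// ge0_fin_numE//.
apply: (@le_lt_trans _ _ (\int[lebesgue_measure]_(x in `[0%R, 1%R]) (cst 1%E x))%E).
  apply: ge0_le_integral => //.
  - by move=> x x01; rewrite lee_fin integrand_ge0.
  - by apply/measurable_EFinP; exact: measurable_integrand.
  - move=> x; rewrite /= in_itv/= => /andP[x0 x1]; rewrite lee_fin.
    rewrite exprn_ile1// /h ?mulr_ge0 ?powR_ge0// mulr_ile1 ?powR_ge0//.
    apply: (@le_trans _ _ (1 `^ b)); last by rewrite powR1.
    by rewrite ge0_ler_powR ?nnegrE ?(ltW b_gt0)// ?subr_ge0 // lerBlDr lerDl.
by rewrite integral_cst//= mul1e lebesgue_measure_itv/= lte01 EFinN sube0 ltry.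
Qed.

Lemma power_integral_ge0 m : 0 <= power_integral m.
Proof. by apply/fine_ge0/integral_ge0 => x x01; rewrite lee_fin integrand_ge0. Qed.

(** The left-hand side is [d] times the beta integral of
   [x ^ m * (1 - x) ^ (d - 1)], and [d - 1 >= b m]. *)
Lemma invr_bin_le d m : b * m%:R + 1 <= d%:R ->
  'C(d + m, m)%:R^-1 <= d%:R * power_integral m.
Proof.
case: d => [|d] bmd.
  by exfalso; have := mulr_ge0 (ltW b_gt0) (ler0n R m); move: bmd; rewrite mulr0n; lra.
have -> : 'C(d.+1 + m, m)%:R^-1 = d.+1%:R * beta_fun m.+1 d.+1 :> R.
  have F k : k`!%:R != 0 :> R by rewrite pnatr_eq0 -lt0n fact_gt0.
  have C0 : 'C(d.+1 + m, m)%:R != 0 :> R by rewrite pnatr_eq0 -lt0n bin_gt0 leq_addl.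
  rewrite beta_fun_fact -addnS [(m + _)%N]addnC natrM.
  have /(congr1 (fun k => k%:R : R)) := bin_fact (leq_addl d.+1 m).
  rewrite addnK factS !natrM => <-; field.
  by rewrite !F C0 ?natr1 ?nat1r ?pnatr_eq0.
rewrite ler_pM2l ?ltr0n// -lee_fin power_integralE EFin_beta_fun.
rewrite integral_XMonemX_restrict setTI; apply: ge0_le_integral => //.
- by move=> x x01; rewrite lee_fin XMonemX_ge0.
- by apply/measurable_EFinP; exact: measurable_XMonemX.
- by apply/measurable_EFinP; exact: measurable_integrand.
move=> x; rewrite /= in_itv/= => /andP[x0 x1]; rewrite lee_fin /XMonemX /h exprMn.
rewrite ler_wpM2l ?exprn_ge0// /unstable.onem.
have [y0 y1] : 0 <= 1 - x /\ 1 - x <= 1 by split; lra.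
move: (1 - x) y0 y1 => y y0 y1; have [yE|y_neq0] := eqVneq y 0.
  case: (posnP m) => [->|m0]; first by rewrite expr0 exprn_ile1.
  rewrite yE expr0n; case: eqP => [dE|_]; last by rewrite exprn_ge0// powR_ge0.
  have : 0 < b * m%:R by rewrite mulr_gt0 ?ltr0n.
  by move: bmd; rewrite dE; lra.
rewrite -(powR_mulrn m)// ?powR_ge0// -powRrM -(powR_mulrn d)//.
apply: ger_powR; first by rewrite y1 lt_neqAle eq_sym y_neq0 y0.
by move: bmd; rewrite -natr1; lra.
Qed.

End BetaBound.

(** * Tightness *)

Section Tightness.
Variables (R : realType) (V : choiceType) (e : rel V) (S T : set V).
Variable G_ : nat -> {fset V}.
Hypotheses (e_sym : symmetric e) (e_lf : locally_finite e).
Hypotheses (e_conn : connected_graph e [set: V]).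
Hypotheses (S_n0 : S !=set0) (G_exh : exhausts e S G_).

Local Notation targets := (targets e T).
Local Notation adm m n := (admissibles R e S (targets (G_ n)) m (G_ n)).

(** The sum over sizes stops at the size of the filling of [G_ n], so [K]
   depends on [n]; the summands do not. *)
Lemma sep_size_tail_le (c : R^nat) M n : (forall m, 0 <= c m) ->
    (forall m k A, (M <= m)%N -> A \in adm m k ->
       'C(bdry_card e S (G_ k) A + m, m)%:R^-1 <= (bdry_card e S (G_ k) A)%:R * c m) ->
  exists K, sep_prob R e S (targets (G_ n)) (G_ n) [pred X | (M <= #|` X|)%N] <=
    \sum_(M <= m < K) bdry_sum_lim R e S T G_ m * c m.
Proof.
move=> c0 binc; have [s Ss] := S_n0.
have [F GF fF] := filled_exists e_sym e_lf e_conn G_exh (exhausts_sources G_exh n Ss).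
have SG := exhausts_sources G_exh n.
have SF : S `<=` [set` F] by move=> t /SG /(fsubsetP GF).
(* Both processes start with no deletions, that is with [W := fset0]. *)
have := @sep_prob_coupling R V e S (targets (G_ n)) (targets F) (G_ n) F M GF.
move=> /(_ (fun W => stop_enlarge GF SG) fset0).
rewrite !fsetD0 (reach_exhausts S_n0 G_exh) => le_filled.
exists #|` F|.+1; apply: le_trans le_filled _.
rewrite (@sep_prob_sum _ _ _ _ _ _ _ F (reach_sub e S F)).
apply: (@le_trans _ _ (\sum_(M <= m < #|` F|.+1) \sum_(A <- fpowerset F | #|` A| == m)
    sep_prob R e S (targets F) (reach e S F) (pred1 A))); last first.
  apply: ler_sum_nat => m /andP[Mm _].
  by apply: (filled_cluster_sum_le _ _ _ _ _ fF SF) => // k A; apply: binc.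
rewrite [leLHS]big_mkcond /=; under [leRHS]eq_bigr do rewrite big_mkcond/=.
rewrite exchange_big/= big_seq [leRHS]big_seq; apply: ler_sum => A.
rewrite fpowersetE => AF; case: leqP => [MA|_]; last first.
  by apply: sumr_ge0 => m _; case: ifP => // _; exact: sep_prob_ge0.
rewrite (bigD1_seq #|` A|) ?iota_uniq ?mem_index_iota ?MA ?ltnS ?fsubset_leq_card//=.
rewrite eqxx lerDl; apply: sumr_ge0 => m _; case: ifP => // _; exact: sep_prob_ge0.
Qed.

End Tightness.

(** By monotone convergence the integral is the sum of the series with terms
   [a m * power_integral b m]. *)
Lemma power_sum_tail (R : realType) (b : R) (L : nat) (a : R^nat) :
    0 < b -> (forall m, 0 <= a m) ->
    (\int[lebesgue_measure]_(x in `[0%R, 1%R])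
       power_sum L a (x * (1 - x) `^ b)%R < +oo)%E ->
  forall eps, 0 < eps -> exists2 M, (L <= M)%N &
    forall K, \sum_(M <= m < K) a m * power_integral b m < eps.
Proof.
move=> b0 a0 int_fin eps eps0.
pose f m : \bar R := (a m * power_integral b m)%:E.
have f0 m : (L <= m)%N -> (0 <= f m)%E.
  by move=> _; rewrite lee_fin mulr_ge0 ?power_integral_ge0.
have f_fin : (\sum_(0 <= m <oo | true && (L <= m)%N) f m < +oo)%E.
  apply: le_lt_trans int_fin; rewrite le_eqVlt; apply/orP; left; apply/eqP.
  rewrite eseries_mkcond.
  pose g m x : \bar R := if (L <= m)%N then (a m * (x * (1 - x) `^ b) ^+ m)%:E else 0%E.
  transitivity (\int[lebesgue_measure]_(x in `[0%R, 1%R]) (\sum_(0 <= m <oo) g m x))%E.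
    rewrite integral_nneseries//.
    - apply: eq_eseriesr => m _; rewrite /g /=; case: leqP => Lm; last by rewrite integral0.
      under [in RHS]eq_integral do rewrite EFinM.
      rewrite ge0_integralZl_EFin//.
      + by rewrite -power_integralE// /f EFinM.
      + by move=> x x01; rewrite lee_fin integrand_ge0.
      + by apply/measurable_EFinP; exact: measurable_integrand.
    - move=> m; rewrite /g; case: (L <= m)%N => //.
      apply/measurable_EFinP; apply: measurable_funM => //; exact: measurable_integrand.
    - by move=> m x x01; rewrite /g; case: ifP => // _; rewrite lee_fin mulr_ge0// integrand_ge0.
  apply: eq_integral => x _; rewrite /power_sum [RHS]eseries_cond [RHS]eseries_mkcond.
  by apply: eq_eseriesr.
have tail0 := nneseries_tail_cvg f_fin f0.
have [N _ tailN] := tail0 _ (@nbhs_open_ereal_lt _ 0 (fun=> eps) eps0).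
exists (maxn L N); first exact: leq_maxl.
move=> K; rewrite -lte_fin -sumEFin.
apply: le_lt_trans (tailN (maxn L N) (leq_maxr _ _)).
apply: le_trans (nneseries_lim_ge K _) => [|m _]; last exact: f0.
rewrite [leRHS]big_mkcond/= big_nat [leRHS]big_nat; apply: lee_sum => m.
by rewrite geq_max => /andP[/andP[-> _] _].
Qed.

Theorem theorem16 (R : realType) (V : choiceType) (e : rel V)
  (e_sym : symmetric e) (e_irr : irreflexive e)
  (e_lf : locally_finite e) (V_inf : infinite_set [set: V])
  (e_conn : connected_graph e [set: V])
  (S T : set V) (S_n0 : S !=set0)
  (G_ : nat -> {fset V}) (G_exh : exhausts e S G_)
  (b : R) (b_gt0 : 0 < b) (L : nat)
  (bdry_ge : forall (m n : nat) (A : {fset V}), (L <= m)%N ->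
     A \in admissibles R e S (targets e T (G_ n)) m (G_ n) ->
     b * m%:R + 1 <= (bdry_card e S (G_ n) A)%:R)
  (f_radius : ((b `^ b / (b + 1) `^ (b + 1))%:E <=
     conv_radius (series_from L (bdry_sum_lim R e S T G_)))%E)
  (f_int : (\int[lebesgue_measure]_(x in `[0%R, 1%R])
     power_sum L (bdry_sum_lim R e S T G_) (x * (1 - x) `^ b)%R < +oo)%E) :
  forall eps : R, 0 < eps -> exists M : nat, forall n : nat,
    (cut_prob R e S (G_ n)
       [set s | (M <= #|` sep_graph e S (targets e T (G_ n)) (G_ n) s|)%N]
     < eps%:E)%E.
Proof.
move=> eps eps0.
have a0 := bdry_sum_lim_ge0 R T e_sym e_lf e_conn S_n0 G_exh.
have [M LM tailM] := power_sum_tail b_gt0 a0 f_int eps0.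
exists M => n.
rewrite (sep_probE _ _ _ _ _ [pred X : {fset V} | (M <= #|` X|)%N]) lte_fin.
have bin_le m k A : (M <= m)%N -> A \in admissibles R e S (targets e T (G_ k)) m (G_ k) ->
    'C(bdry_card e S (G_ k) A + m, m)%:R^-1 <=
      (bdry_card e S (G_ k) A)%:R * power_integral b m.
  by move=> Mm /bdry_ge bm; apply: invr_bin_le => //; apply/bm/(leq_trans LM).
have [K size_le] := sep_size_tail_le e_sym e_lf e_conn S_n0 G_exh n
  (power_integral_ge0 b) bin_le.
by apply: le_lt_trans size_le _; exact: tailM.
Qed.
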